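(* For all nonnegative integers $n$ and $k$, $$\sum_{j=-k}^{k} (-1)^j q^{\frac{j(3j-1)}{2}} \begin{bmatrix} \lfloor \frac{n+j}{2} \rfloor \\ k-j \end{bmatrix} \begin{bmatrix} \lfloor \frac{n-j+1}{2} \rfloor \\ k+j \end{bmatrix} = \begin{bmatrix} n-k \\ k \end{bmatrix}.$$
   Context: $q$ is an indeterminate and $\lfloor x\rfloor$ denotes the largest integer $\le x$. For integers $m$ and $k$, the $q$-binomial coefficient is $\begin{bmatrix} m \\ k \end{bmatrix} = \prod_{i=1}^{k}\frac{1-q^{m-k+i}}{1-q^{i}}$ if $0\le k\le m$, and $\begin{bmatrix} m \\ k \end{bmatrix}=0$ otherwise (in particular it is $0$ when $m<0$). *)

(* Defs.v *)
From HB Require Import structures.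
From mathcomp Require Export all_boot all_order all_algebra.
Set Implicit Arguments.
Unset Strict Implicit.
Unset Printing Implicit Defensive.
Import Order.TTheory GRing.Theory Num.Theory.
Local Open Scope ring_scope.

(* The field Q(q) of rational functions, so that the quotients below are
   genuine: 1 - q ^ i <> 0 for every i <> 0. *)
Definition ratfun : fieldType := {fraction {poly rat}}.

Definition q : ratfun := tofrac 'X.

Definition qbinom (m k : int) : ratfun :=
  if 0 <= k <= m then
    \prod_(1 <= i < `|k|%N.+1) ((1 - q ^ (m - k + i%:Z)) / (1 - q ^ i%:Z))
  else 0.

(* Main.v *)
Require Import Defs.
From HB Require Import structures.
From mathcomp Require Import all_boot all_order all_algebra.
From mathcomp Require Import zify ring.
Import Order.TTheory GRing.Theory Num.Theory.
Local Open Scope ring_scope.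

(** Both sides satisfy [f n k = f (n - 1) k + q ^ (n - 2k) f (n - 2) (k - 1)].
    For the right-hand side this is the q-Pascal rule.  On the left-hand side,
    the q-Pascal rule shows that the summands indexed by [j] satisfy the
    recurrence up to a defect, and the defects of [j] and [j + 1] are opposite
    whenever [n + j] is even; hence the defect is a difference in [j] and
    telescopes away. *)

Section QuantumParameter.

Variables (F : fieldType) (x : F).
Hypothesis x_neq0 : x != 0.
Hypothesis one_sub_x_neq0 : forall i : nat, 1 - x ^ i.+1%:Z != 0.

Lemma xzD (a b : int) : x ^ (a + b) = x ^ a * x ^ b.
Proof. by rewrite expfzDr // x_neq0. Qed.

(** For [d >= 0] this is the Gaussian binomial with top [d + k] and bottom [k]. Indexed by [d], it
    makes sense for every integer and satisfies Pascal's rule without side conditions. *)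
Definition qprod (d : int) (k : nat) : F :=
  \prod_(1 <= i < k.+1) ((1 - x ^ (d + i%:Z)) / (1 - x ^ i%:Z)).

Lemma qprodS (d : int) (k : nat) :
  qprod d k.+1 = qprod d k * ((1 - x ^ (d + k.+1%:Z)) / (1 - x ^ k.+1%:Z)).
Proof. by rewrite /qprod big_nat_recr. Qed.

(** Shifting the index by one, the numerators on the left are those of [qprod d k] together with
    [1 - x ^ d]. *)
Lemma qprod_pred (d : int) (k : nat) :
  qprod (d - 1) k.+1 = qprod d k * ((1 - x ^ d) / (1 - x ^ k.+1%:Z)).
Proof.
elim: k => [|k IHk].
  by rewrite /qprod big_nat1 big_geq // mul1r subrK.
rewrite qprodS IHk qprodS.
have -> : d - 1 + k.+2%:Z = d + k.+1%:Z by lia.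
by field; rewrite !one_sub_x_neq0.
Qed.

Lemma qprod_pascal (d : int) (k : nat) :
  qprod d k.+1 = qprod (d - 1) k.+1 + x ^ d * qprod d k.
Proof.
rewrite qprodS qprod_pred xzD.
by field; rewrite one_sub_x_neq0.
Qed.

Definition gauss_binom (m k : int) : F :=
  if 0 <= k <= m then qprod (m - k) `|k|%N else 0.

Lemma gauss_binom_eq0 (m k : int) : (k < 0) || (m < k) -> gauss_binom m k = 0.
Proof. by rewrite /gauss_binom => h; case: ifP => // h'; exfalso; lia. Qed.

Lemma gauss_binom_qprod (m : int) (k : nat) :
  k%:Z <= m -> gauss_binom m k%:Z = qprod (m - k%:Z) k.
Proof. by rewrite /gauss_binom => ->. Qed.

Lemma gauss_binom0 (m : int) : 0 <= m -> gauss_binom m 0 = 1.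
Proof. by move=> h; rewrite (@gauss_binom_qprod m 0) // /qprod big_geq. Qed.

(** At [m = k = 0] the left side is 1 and the right side 0, hence the hypothesis. *)
Lemma gauss_binom_pascal (m k : int) : (m != 0) || (k != 0) ->
  gauss_binom m k =
  gauss_binom (m - 1) k + x ^ (m - k) * gauss_binom (m - 1) (k - 1).
Proof.
move=> mk0.
have [km|mk] := leP k m; last by rewrite !gauss_binom_eq0 ?mulr0 ?addr0 //; lia.
case: k km mk0 => [[|k]|k] km mk0.
- by rewrite (@gauss_binom_eq0 _ (0 - 1)) // !gauss_binom0 ?mulr0 ?addr0 //; lia.
- have -> : k.+1%:Z - 1 = k%:Z by lia.
  rewrite (gauss_binom_qprod _ _ km) (@gauss_binom_qprod _ k); last by lia.
  rewrite qprod_pascal.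
  have -> : m - 1 - k%:Z = m - k.+1%:Z by lia.
  congr (_ + _).
  (* On the diagonal the cut-off makes the right side 0; the product agrees because it contains the
     factor [1 - x ^ 0]. *)
  have [d0|d0] := eqVneq m k.+1%:Z.
    rewrite gauss_binom_eq0; last by lia.
    by rewrite qprod_pred d0 subrr expr0z subrr mul0r mulr0.
  rewrite gauss_binom_qprod; last by lia.
  by congr (qprod _ _); lia.
- by rewrite !gauss_binom_eq0 ?mulr0 ?addr0 //; lia.
Qed.

Definition pentagonal (j : int) : int := (j * (3 * j - 1) %/ 2)%Z.

Lemma pentagonalE (j : int) : pentagonal j * 2 = j * (3 * j - 1).
Proof.
apply: divzK; apply/dvdzP.
have -> : j = (j %/ 2)%Z * 2 + (j %% 2)%Z by lia.
have [->|->] : (j %% 2)%Z = 0 \/ (j %% 2)%Z = 1 by lia.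
- by exists ((j %/ 2)%Z * (3 * ((j %/ 2)%Z * 2) - 1)); ring.
- by exists (((j %/ 2)%Z * 2 + 1) * (3 * (j %/ 2)%Z + 1)); ring.
Qed.

Definition summand (n k j : int) : F :=
  (-1) ^ j * x ^ pentagonal j
    * gauss_binom ((n + j) %/ 2)%Z (k - j)
    * gauss_binom ((n - j + 1) %/ 2)%Z (k + j).

Lemma summand_eq0 (n k j : int) : (j < - k) || (k < j) -> summand n k j = 0.
Proof.
case/orP=> h; rewrite /summand.
- by rewrite (@gauss_binom_eq0 _ (k + j)) ?mulr0 //; lia.
- by rewrite (@gauss_binom_eq0 _ (k - j)) ?mulr0 ?mul0r //; lia.
Qed.

(** For [n + j] odd this is the defect of [j - 1], and also minus the defect of [j]. *)
Definition certificate (n k j : int) : F :=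
  if ((n + j) %% 2)%Z == 0 then 0 else
  - ((-1) ^ j * x ^ (pentagonal j + ((n + 1 - 3 * j) %/ 2)%Z - k)
     * gauss_binom (((n + j) %/ 2)%Z - 1) (k - j)
     * gauss_binom (((n - j + 1) %/ 2)%Z - 1) (k + j - 1)).

Lemma summand_telescope (n k j : int) : 2 <= n -> 1 <= k ->
  summand n k j - summand (n - 1) k j
    - x ^ (n - 2 * k) * summand (n - 2) (k - 1) j
  = certificate n k (j + 1) - certificate n k j.
Proof.
move=> n2 k1; rewrite /summand /certificate.
(* Together these give [pentagonal (j + 1) - pentagonal j = 3 * j + 1], which matches the exponents
   below. *)
have E1 := pentagonalE j; have E2 := pentagonalE (j + 1).
have S1 : (-1) ^ (j + 1) = - (-1) ^ j :> F.
  by rewrite expfzDr ?oppr_eq0 ?oner_eq0 // expr1z mulrN1.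
set c := ((n + j) %/ 2)%Z.
have [ev|od] := eqVneq ((n + j) %% 2)%Z 0.
(* Passing from [n] to [n - 1] lowers only the first top entry [c]. Pascal on both factors leaves
   one product, [certificate n k (j + 1)]. *)
- have -> : ((n + (j + 1)) %% 2)%Z == 0 = false by lia.
  have -> : ((n - j + 1) %/ 2)%Z = n - c by lia.
  have -> : ((n - 1 + j) %/ 2)%Z = c - 1 by lia.
  have -> : ((n - 1 - j + 1) %/ 2)%Z = n - c by lia.
  have -> : ((n - 2 + j) %/ 2)%Z = c - 1 by lia.
  have -> : ((n - 2 - j + 1) %/ 2)%Z = n - c - 1 by lia.
  have -> : ((n + (j + 1)) %/ 2)%Z = c by lia.
  have -> : ((n - (j + 1) + 1) %/ 2)%Z = n - c by lia.
  have -> : pentagonal (j + 1) + ((n + 1 - 3 * (j + 1)) %/ 2)%Z - k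
            = pentagonal j + (c - (k - j)) by lia.
  have -> : n - 2 * k = (c - (k - j)) + (n - c - (k + j)) by lia.
  have -> : k - (j + 1) = k - j - 1 by lia.
  have -> : k + (j + 1) - 1 = k + j by lia.
  have -> : k - 1 - j = k - j - 1 by lia.
  have -> : k - 1 + j = k + j - 1 by lia.
  (* If [k - j = 0] then [j >= 1] and [c >= 1], so the excluded case of Pascal's rule does not
     occur; similarly for the other factor. *)
  rewrite S1 (@gauss_binom_pascal c); last by lia.
  rewrite (@gauss_binom_pascal (n - c)); last by lia.
  rewrite (xzD (pentagonal j)) (xzD (c - (k - j)) (n - c - (k + j))).
  by ring.
(* Now only the second top entry [n - c] drops, so the two factors exchange roles. *)
- have -> : ((n + (j + 1)) %% 2)%Z == 0 by lia.
  have -> : ((n - j + 1) %/ 2)%Z = n - c by lia.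
  have -> : ((n - 1 + j) %/ 2)%Z = c by lia.
  have -> : ((n - 1 - j + 1) %/ 2)%Z = n - c - 1 by lia.
  have -> : ((n - 2 + j) %/ 2)%Z = c - 1 by lia.
  have -> : ((n - 2 - j + 1) %/ 2)%Z = n - c - 1 by lia.
  have -> : pentagonal j + ((n + 1 - 3 * j) %/ 2)%Z - k
            = pentagonal j + (n - c - (k + j)) by lia.
  have -> : n - 2 * k = (c - (k - j)) + (n - c - (k + j)) by lia.
  have -> : k - 1 - j = k - j - 1 by lia.
  have -> : k - 1 + j = k + j - 1 by lia.
  rewrite (@gauss_binom_pascal c); last by lia.
  rewrite (@gauss_binom_pascal (n - c)); last by lia.
  rewrite (xzD (pentagonal j)) (xzD (c - (k - j)) (n - c - (k + j))).
  by ring.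
Qed.

Definition summand_sum (n k : nat) : F :=
  \sum_(0 <= i < (2 * k).+1) summand n%:Z k%:Z (i%:Z - k%:Z).

Lemma summand_sum_rec (n k : nat) :
  summand_sum n.+2 k.+1 =
  summand_sum n.+1 k.+1 + x ^ (n%:Z - 2 * k%:Z) * summand_sum n k.
Proof.
pose G (i : nat) := certificate n.+2%:Z k.+1%:Z (i%:Z - k.+1%:Z).
have cert0 : \sum_(0 <= i < (2 * k.+1).+1) (G i.+1 - G i) = 0.
  rewrite telescope_sumr // /G /certificate.
  (* At either end of the telescope a lower index equals -1. *)
  rewrite (@gauss_binom_eq0 _ (k.+1%:Z - _)); last by lia.
  rewrite (@gauss_binom_eq0 _ (k.+1%:Z + (0%:Z - _) - 1)); last by lia.
  by rewrite !mulr0 !mul0r oppr0 !if_same subr0.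
(* Widening the range by a zero summand at each end aligns all three sums on the same [j]. *)
have -> : summand_sum n k =
    \sum_(0 <= i < (2 * k.+1).+1) summand n%:Z k%:Z (i%:Z - k.+1%:Z).
  have -> : (2 * k.+1).+1 = (2 * k).+3 by lia.
  rewrite big_nat_recl // big_nat_recr //=.
  rewrite (@summand_eq0 n%:Z k%:Z (0%:Z - _)) ?add0r; last by lia.
  rewrite (@summand_eq0 n%:Z k%:Z ((2 * k).+2%:Z - _)) ?addr0; last by lia.
  by apply: eq_bigr => i _; congr summand; lia.
apply/eqP; rewrite -subr_eq0 opprD addrA -[X in _ == X]cert0 mulr_sumr.
rewrite /summand_sum -!sumrB; apply/eqP; apply: eq_bigr => i _.
have -> : G i.+1 = certificate n.+2%:Z k.+1%:Z (i%:Z - k.+1%:Z + 1).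
  by congr certificate; lia.
rewrite -summand_telescope; [|lia|lia].
have -> : n.+2%:Z - 1 = n.+1%:Z by lia.
have -> : n.+2%:Z - 2 = n%:Z by lia.
have -> : k.+1%:Z - 1 = k%:Z by lia.
by have -> : n.+2%:Z - 2 * k.+1%:Z = n%:Z - 2 * k%:Z by lia.
Qed.

(** The two tops add up to [n] and the two bottoms to [2 * k], so some bottom exceeds its top. *)
Lemma summand_sum_eq0 (n k : nat) : (n < 2 * k)%N -> summand_sum n k = 0.
Proof.
move=> nk; apply: big1 => i _; rewrite /summand; move: (_ - _) => j.
have [h|h] := ltP ((n%:Z + j) %/ 2)%Z (k%:Z - j).
  by rewrite (@gauss_binom_eq0 _ (k%:Z - j)) ?h ?orbT // mulr0 mul0r.
by rewrite (@gauss_binom_eq0 _ (k%:Z + j)) ?mulr0 //; lia.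
Qed.

Lemma summand_sumn0 (n : nat) : summand_sum n 0 = 1.
Proof.
rewrite /summand_sum big_nat1 /summand !gauss_binom0 ?mulr1; [|lia|lia].
exact: expr0z.
Qed.

Lemma summand_sumE (n k : nat) : summand_sum n k = gauss_binom (n%:Z - k%:Z) k%:Z.
Proof.
(* Strong induction on [n], as the recurrence reaches back two steps; the cases [n < 2 * k] and
   [k = 0] start it. *)
have [m] := ubnP n; elim: m n k => // m IHm n k nm.
have [nk|kn] := ltnP n (2 * k).
  by rewrite summand_sum_eq0 // gauss_binom_eq0 //; lia.
case: k kn => [|k] kn; first by rewrite summand_sumn0 gauss_binom0 //; lia.
case: n nm kn => [|[|n]] nm kn; [lia|lia|].
rewrite summand_sum_rec !IHm; [|lia|lia].
rewrite (@gauss_binom_pascal (n.+2%:Z - k.+1%:Z)); last by lia.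
have -> : n.+2%:Z - k.+1%:Z - 1 = n.+1%:Z - k.+1%:Z by lia.
have -> : n.+2%:Z - k.+1%:Z - k.+1%:Z = n%:Z - 2 * k%:Z by lia.
have -> : n.+1%:Z - k.+1%:Z = n%:Z - k%:Z by lia.
by have -> : k.+1%:Z - 1 = k%:Z by lia.
Qed.

End QuantumParameter.

Lemma q_neq0 : q != 0.
Proof. by rewrite /q tofrac_eq0 polyX_eq0. Qed.

Lemma one_sub_qX_neq0 (i : nat) : 1 - q ^ i.+1%:Z != 0.
Proof.
rewrite subr_eq0 eq_sym -exprnP /q -tofracXn -tofrac1 tofrac_eq.
apply/eqP => /(congr1 (fun p : {poly rat} => size p)).
by rewrite size_polyXn size_poly1.
Qed.

(* The summation index j runs over -k, ..., k as j = i - k with 0 <= i <= 2k;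
   divz by 2 is the floor, also for negative numerators. *)
Theorem theorem2 (n k : nat) :
  \sum_(0 <= i < (2 * k).+1)
     (let j : int := i%:Z - k%:Z in
      (-1) ^ j * q ^ (j * (3 * j - 1) %/ 2)%Z
        * qbinom ((n%:Z + j) %/ 2)%Z (k%:Z - j)
        * qbinom ((n%:Z - j + 1) %/ 2)%Z (k%:Z + j))
  = qbinom (n%:Z - k%:Z) k%:Z.
(* [qbinom] is convertible to [gauss_binom] at [x := q]. *)
Proof. exact: (summand_sumE _ _ q_neq0 one_sub_qX_neq0). Qed.
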